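(* Let $T>0$ and let $h\in C^\infty([0,T]\times\mathbf{T})$ be a smooth positive solution to the Boussinesq equation in space dimension $1$, $$\partial_th-\partial_x(h\,\partial_xh)=0 .$$ Then, for all $t\in[0,T]$, $$\frac{d}{dt}\int_{\mathbf{T}}(\partial_xh)\arctan(\partial_xh)\,dx\le0 .$$
   Context: $\mathbf{T}$ is the one-dimensional torus (circle). *)

(* Defs.v *)
From Stdlib Require Import Reals.
From Coquelicot Require Import Coquelicot.
Open Scope R_scope.

(* Coquelicot's [is_derive] with [locally x] replaced by its trace on [D]:
   the derivative of [f] at [x] along points of [D]. For [D = [0,T]] it is
   one-sided at the two endpoints. *)
Definition is_derive_on (D : R -> Prop) (f : R -> R) (x l : R) : Prop :=
  filterdiff f (within D (locally x)) (fun y : R => scal y l).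

Definition Icc (a b : R) : R -> Prop := fun t => a <= t <= b.

(* A function on [0,T] x R/(2 PI Z) is a map [f : R -> R -> R], time first, that is
   2*PI-periodic in space; its values at times outside [0,T] are irrelevant.
   [Ck_strip T n f]: all partial derivatives of [f] of order at most [n] exist
   and are jointly continuous on the closed strip [0,T] x R. *)
Fixpoint Ck_strip (T : R) (n : nat) (f : R -> R -> R) : Prop :=
  continuous_on (fun p : R * R => Icc 0 T (fst p))
                (fun p : R * R => f (fst p) (snd p)) /\
  match n with
  | O => True
  | S m =>
      exists ft fx : R -> R -> R,
        (forall t x, Icc 0 T t ->
           is_derive_on (Icc 0 T) (fun s => f s x) t (ft t x)) /\
        (forall t x, Icc 0 T t -> is_derive (fun y => f t y) x (fx t x)) /\
        Ck_strip T m ft /\ Ck_strip T m fx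
  end.

Definition smooth_on_torus (T : R) (f : R -> R -> R) : Prop :=
  (forall t x, Icc 0 T t -> f t (x + 2 * PI) = f t x) /\
  (forall n, Ck_strip T n f).

Definition partial_x (f : R -> R -> R) (t x : R) : R := Derive (fun y => f t y) x.

Definition boussinesq_solution (T : R) (h : R -> R -> R) : Prop :=
  forall t x, Icc 0 T t ->
    exists ht : R,
      is_derive_on (Icc 0 T) (fun s => h s x) t ht /\
      ht - partial_x (fun s y => h s y * partial_x h s y) t x = 0.

(* Main.v *)
(* With u = h_x and g(u) = u arctan u, the derivative of the functional is the
   integral of g'(u) u_t = g'(u) h_tx. Since g''(u) = 2/(1+u^2)^2 and
   h_t = u^2 + h u_x, the Leibniz rule gives
     g'(u) h_tx = d/dx [g'(u) h_t - G(u)] - 2 h u_x^2 / (1+u^2)^2,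
   where G(u) = arctan u - u/(1+u^2) satisfies G'(u) = 2u^2/(1+u^2)^2. The
   bracket is periodic and h > 0, so the integral is nonpositive.
   All time derivatives are taken within [0,T]; one-sided differentiability at
   the endpoints is obtained from the mean value theorem applied in the open
   interval after composing with the projection of R onto [0,T]. *)
Require Import Defs.
From Stdlib Require Import Reals Lra.
From Coquelicot Require Import Coquelicot.
Open Scope R_scope.

(** * Derivatives along a subset of the line *)

(** [filterdiff] speaks of every limit of the trace filter. Membership of [x] in [D] makes [x] the
    only one: a limit [z] other than [x] would have a ball of radius |x - z| that contains [x]. *)
Lemma is_derive_onP (D : R -> Prop) (f : R -> R) (x l : R) : D x ->
  is_derive_on D f x l <->
  forall eps : posreal, exists delta : posreal, forall y, D y ->
    Rabs (y - x) < delta -> Rabs (f y - f x - (y - x) * l) <= eps * Rabs (y - x).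
Proof.
  intros Dx; split.
  - intros [_ H] eps.
    destruct (H x) with (eps := eps) as [d Hd].
    + intros P HP. apply filter_le_within. exact HP.
    + exists d. intros y Dy Hy. exact (Hd y Hy Dy).
  - intros H; split; [exact (is_linear_scal_l (V := R_NormedModule) l)|].
    intros z Hz eps.
    assert (E : z = x).
    { destruct (Req_dec z x) as [E|E]; [exact E|exfalso].
      assert (P : 0 < Rabs (x - z)) by (apply Rabs_pos_lt; lra).
      specialize (Hz (ball z (mkposreal _ P)) (locally_ball z (mkposreal _ P))).
      destruct Hz as [d Hd].
      specialize (Hd x (ball_center x d) Dx).
      change (Rabs (x - z) < Rabs (x - z)) in Hd. lra. }
    subst z.
    destruct (H eps) as [d Hd]. exists d. intros y Hy Dy. exact (Hd y Dy Hy).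
Qed.

Lemma is_derive_on_ext (D : R -> Prop) (f g : R -> R) (x l : R) : D x ->
  (forall y, D y -> f y = g y) -> is_derive_on D f x l -> is_derive_on D g x l.
Proof.
  intros Dx E H. apply is_derive_onP; [exact Dx|]. intros eps.
  destruct (proj1 (is_derive_onP D f x l Dx) H eps) as [d Hd].
  exists d. intros y Dy Hy. rewrite <- !E by assumption. now apply Hd.
Qed.

Lemma is_derive_on_minus (D : R -> Prop) (f g : R -> R) (x l m : R) :
  is_derive_on D f x l -> is_derive_on D g x m ->
  is_derive_on D (fun y => f y - g y) x (l - m).
Proof.
  intros Hf Hg.
  apply (filterdiff_ext_lin _ (fun y : R => minus (scal y l) (scal y m))).
  - exact (filterdiff_minus_fct f g _ _ Hf Hg).
  - intros y. unfold minus, plus, opp, scal; simpl. unfold mult; simpl. ring.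
Qed.

(** Since [a < b], every point of the interval, endpoints included, is approached by other points of
    it: from the right if [x < b], from the left otherwise. *)
Lemma is_derive_on_Icc_unique (a b : R) (f : R -> R) (x l m : R) : a < b ->
  Icc a b x -> is_derive_on (Icc a b) f x l -> is_derive_on (Icc a b) f x m ->
  l = m.
Proof.
  intros ab Dx Hl Hm.
  destruct (Req_dec l m) as [E|E]; [exact E|exfalso].
  (* With this tolerance the two expansions at a common [y] give |y - x| |l - m| <= (2/3) |y - x| |l
     - m|, which is absurd when [y] differs from [x]. *)
  assert (P : 0 < Rabs (l - m) / 3).
  { assert (0 < Rabs (l - m)) by (apply Rabs_pos_lt; lra). lra. }
  destruct (proj1 (is_derive_onP _ f x l Dx) Hl (mkposreal _ P)) as [d1 H1].
  destruct (proj1 (is_derive_onP _ f x m Dx) Hm (mkposreal _ P)) as [d2 H2].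
  assert (Y : exists y, Icc a b y /\ 0 < Rabs (y - x) < Rmin d1 d2).
  { assert (0 < Rmin d1 d2) by (apply Rmin_glb_lt; apply cond_pos).
    unfold Icc in *.
    destruct (Rlt_dec x b) as [xb|xb].
    - exists (x + Rmin (b - x) (Rmin d1 d2 / 2)).
      assert (0 < Rmin (b - x) (Rmin d1 d2 / 2)) by (apply Rmin_glb_lt; lra).
      pose proof (Rmin_l (b - x) (Rmin d1 d2 / 2)).
      pose proof (Rmin_r (b - x) (Rmin d1 d2 / 2)).
      rewrite Rabs_right; lra.
    - exists (x - Rmin (x - a) (Rmin d1 d2 / 2)).
      assert (0 < Rmin (x - a) (Rmin d1 d2 / 2)) by (apply Rmin_glb_lt; lra).
      pose proof (Rmin_l (x - a) (Rmin d1 d2 / 2)).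
      pose proof (Rmin_r (x - a) (Rmin d1 d2 / 2)).
      rewrite Rabs_left; lra. }
  destruct Y as [y [Dy [Y0 Y1]]].
  pose proof (Rmin_l d1 d2). pose proof (Rmin_r d1 d2).
  specialize (H1 y Dy ltac:(lra)). specialize (H2 y Dy ltac:(lra)).
  simpl in H1, H2.
  assert (H3 : Rabs ((y - x) * (l - m)) <= 2 * (Rabs (l - m) / 3 * Rabs (y - x))).
  { replace ((y - x) * (l - m))
      with ((f y - f x - (y - x) * m) - (f y - f x - (y - x) * l)) by ring.
    eapply Rle_trans; [apply Rabs_triang|]. rewrite Rabs_Ropp. lra. }
  rewrite Rabs_mult in H3.
  assert (0 < Rabs (y - x) * (Rabs (l - m) / 3)) by (apply Rmult_lt_0_compat; lra).
  lra.
Qed.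

Lemma is_derive_on_interior (a b : R) (f : R -> R) (x l : R) : a < x < b ->
  is_derive_on (Icc a b) f x l -> is_derive f x l.
Proof.
  intros Hx [Hl H]. split; [exact Hl|]. intros z Hz eps.
  rewrite <- (is_filter_lim_locally_unique (K := R_AbsRing) (V := R_NormedModule) _ _ Hz).
  specialize (H x (fun P HP => filter_le_within _ P HP) eps).
  assert (L : locally x (Icc a b)).
  { apply (filter_imp (fun y => a < y /\ y < b)).
    - intros y; unfold Icc; lra.
    - apply filter_and; [apply open_gt | apply open_lt]; lra. }
  generalize (filter_and _ _ L H). apply filter_imp. intros y [Dy Hy]; auto.
Qed.

(** * Continuity on the closed strip, with time projected onto [0,T] *)

Definition clamp (T t : R) : R := Rmax 0 (Rmin T t).

Lemma clamp_Icc (T t : R) : 0 <= T -> Icc 0 T (clamp T t).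
Proof.
  intros; unfold clamp, Icc, Rmax, Rmin; repeat destruct Rle_dec; lra.
Qed.

Lemma clamp_id (T t : R) : Icc 0 T t -> clamp T t = t.
Proof.
  unfold clamp, Icc, Rmax, Rmin; repeat destruct Rle_dec; lra.
Qed.

Lemma clamp_lipschitz (T s t : R) : Rabs (clamp T s - clamp T t) <= Rabs (s - t).
Proof.
  unfold clamp, Rmax, Rmin; repeat destruct Rle_dec;
    unfold Rabs; repeat destruct Rcase_abs; lra.
Qed.

(** Values at times outside [0,T] carry no information. Projecting time first turns continuity on
    the closed strip into continuity at every point of the plane, so two-sided results apply at the
    endpoints too. *)
Definition continuous_strip (T : R) (f : R -> R -> R) : Prop :=
  forall t x, continuity_2d_pt (fun s y => f (clamp T s) y) t x.

Lemma continuous_on_strip (T : R) (f : R -> R -> R) : 0 <= T ->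
  continuous_on (fun p : R * R => Icc 0 T (fst p))
    (fun p : R * R => f (fst p) (snd p)) ->
  continuous_strip T f.
Proof.
  intros hT H t x eps.
  specialize (H (clamp T t, x) (clamp_Icc T t hT)).
  destruct (H (ball (f (clamp T t) x) eps) (locally_ball _ eps)) as [d Hd].
  exists d. intros s y Hs Hy.
  apply (Hd (clamp T s, y)).
  - split; [|exact Hy].
    exact (Rle_lt_trans _ _ _ (clamp_lipschitz T s t) Hs).
  - exact (clamp_Icc T s hT).
Qed.

Lemma continuous_strip_comp (T : R) (g : R -> R) (f : R -> R -> R) :
  (forall u, continuous g u) -> continuous_strip T f ->
  continuous_strip T (fun t x => g (f t x)).
Proof.
  intros Hg Hf t x.
  apply (continuity_1d_2d_pt_comp g (fun s y => f (clamp T s) y)); [|apply Hf].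
  apply continuity_pt_filterlim, Hg.
Qed.

Lemma continuous_strip_space (T : R) (f : R -> R -> R) (t : R) :
  continuous_strip T f -> Icc 0 T t -> forall x, continuous (f t) x.
Proof.
  intros H Dt x. apply continuity_pt_filterlim, continuity_pt_locally. intros eps.
  destruct (H t x eps) as [d Hd]. exists d. intros y Hy.
  rewrite <- (clamp_id T t Dt). apply (Hd t y); [|exact Hy].
  rewrite Rminus_diag, Rabs_R0. apply cond_pos.
Qed.

Lemma continuous_strip_time (T : R) (f : R -> R -> R) (x : R) :
  continuous_strip T f -> forall t, continuity_pt (fun s => f (clamp T s) x) t.
Proof.
  intros H t. apply continuity_pt_locally. intros eps.
  destruct (H t x eps) as [d Hd]. exists d. intros s Hs.
  apply (Hd s x); [exact Hs|].
  rewrite Rminus_diag, Rabs_R0. apply cond_pos.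
Qed.

(** * Differentiation under the integral and symmetry of mixed partials *)

(** The mean value theorem asks for a derivative only strictly between [s] and [t], hence inside
    (0,T). At the endpoints continuity suffices, and the clamped function has it even at 0 and
    [T]. *)
Lemma strip_mean_value (T : R) (f ft : R -> R -> R) (s t x : R) :
  continuous_strip T f ->
  (forall r, 0 < r < T -> is_derive (fun r => f r x) r (ft r x)) ->
  Icc 0 T s -> Icc 0 T t ->
  exists c, Icc 0 T c /\ Rabs (c - t) <= Rabs (s - t) /\
    f s x - f t x = ft c x * (s - t).
Proof.
  intros Cf Df Ds Dt.
  destruct (MVT_gen (fun r => f (clamp T r) x) t s (fun r => ft r x))
    as [c [Hc E]].
  - intros r Hr. assert (R : 0 < r < T).
    { unfold Icc, Rmin, Rmax in *; destruct Rle_dec; lra. }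
    apply (is_derive_ext_loc (fun r => f r x)); [|now apply Df].
    apply (filter_imp (fun y => 0 < y /\ y < T)).
    + intros y Hy. rewrite clamp_id; [reflexivity|unfold Icc; lra].
    + apply filter_and; [apply open_gt | apply open_lt]; lra.
  - intros r _. now apply continuous_strip_time.
  - rewrite !clamp_id in E by assumption.
    exists c. repeat split; try exact E;
      unfold Icc, Rmin, Rmax, Rabs in *; repeat destruct Rle_dec;
      repeat destruct Rcase_abs; lra.
Qed.

(** By the mean value theorem the first-order error of the integrand at [x] is (ft c x - ft t x)(s -
    t) with [c] no farther from [t] than [s]. Uniform continuity of [ft] near the segment {t} x
    [a,b] makes it small uniformly in [x]. *)
Lemma is_derive_on_RInt_param (T : R) (f ft : R -> R -> R) (a b t : R) :
  a <= b -> continuous_strip T f -> continuous_strip T ft ->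
  (forall s x, 0 < s < T -> is_derive (fun r => f r x) s (ft s x)) ->
  Icc 0 T t ->
  is_derive_on (Icc 0 T) (fun s => RInt (f s) a b) t (RInt (ft t) a b).
Proof.
  intros ab Cf Cft Df Dt.
  assert (If : forall s, Icc 0 T s -> ex_RInt (f s) a b).
  { intros s Ds. apply (ex_RInt_continuous (V := R_CompleteNormedModule)).
    intros x _. now apply (continuous_strip_space T). }
  assert (Ift : ex_RInt (ft t) a b).
  { apply (ex_RInt_continuous (V := R_CompleteNormedModule)).
    intros x _. now apply (continuous_strip_space T). }
  apply is_derive_onP; [exact Dt|]. intros eps.
  (* The added 1 keeps the denominator positive when [a = b]; integration over length b - a then
     leaves the factor (b - a)/(b - a + 1) <= 1. *)
  assert (P : 0 < eps / (b - a + 1)).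
  { apply Rdiv_lt_0_compat; [apply cond_pos|lra]. }
  destruct (uniform_continuity_2d_1d' (fun s x => ft (clamp T s) x) a b t
    (fun x _ => Cft t x) (mkposreal _ P)) as [d Hd].
  exists d. intros s Ds Hs.
  assert (E : is_RInt (fun x => f s x - f t x - (s - t) * ft t x) a b
    (RInt (f s) a b - RInt (f t) a b - (s - t) * RInt (ft t) a b)).
  { apply (is_RInt_minus (V := R_NormedModule)).
    - apply (is_RInt_minus (V := R_NormedModule)); apply (RInt_correct (V := R_CompleteNormedModule)); auto.
    - apply (is_RInt_scal (V := R_NormedModule)). now apply (RInt_correct (V := R_CompleteNormedModule)). }
  rewrite <- (is_RInt_unique _ _ _ _ E).
  apply Rle_trans with ((b - a) * (eps / (b - a + 1) * Rabs (s - t))).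
  - apply abs_RInt_le_const; [exact ab|eexists; exact E|]. intros x Hx.
    destruct (strip_mean_value T f ft s t x) as [c [Dc [Hc Ec]]]; auto.
    rewrite Ec.
    replace (ft c x * (s - t) - (s - t) * ft t x)
      with ((ft c x - ft t x) * (s - t)) by ring.
    rewrite Rabs_mult. apply Rmult_le_compat_r; [apply Rabs_pos|]. apply Rlt_le.
    rewrite <- (clamp_id T c Dc), <- (clamp_id T t Dt) at 1.
    pose proof (cond_pos d).
    assert (K : Rabs (c - t) < d) by lra. apply Rabs_lt_between in K.
    apply Hd; try lra. rewrite Rminus_diag, Rabs_R0. lra.
  - pose proof (cond_pos eps).
    replace ((b - a) * (eps / (b - a + 1) * Rabs (s - t)))
      with ((b - a) / (b - a + 1) * (eps * Rabs (s - t))) by (field; lra).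
    rewrite <- (Rmult_1_l (eps * Rabs (s - t))) at 2.
    apply Rmult_le_compat_r.
    + apply Rmult_le_pos; [lra|apply Rabs_pos].
    + apply Rle_div_l; lra.
Qed.

(* Schwarz's theorem up to the boundary of the strip: differentiate
   f(t,y) - f(t,a) = RInt (fx t) a y within [0,T], then in y. *)
Lemma mixed_partials_strip (T : R) (f ft fx ftx fxt : R -> R -> R) : 0 < T ->
  continuous_strip T fx -> continuous_strip T fxt ->
  (forall t x, Icc 0 T t -> is_derive_on (Icc 0 T) (fun s => f s x) t (ft t x)) ->
  (forall t x, Icc 0 T t -> is_derive (f t) x (fx t x)) ->
  (forall t x, Icc 0 T t -> is_derive_on (Icc 0 T) (fun s => fx s x) t (fxt t x)) ->
  (forall t x, Icc 0 T t -> is_derive (ft t) x (ftx t x)) ->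
  forall t x, Icc 0 T t -> fxt t x = ftx t x.
Proof.
  intros hT Cfx Cfxt Hft Hfx Hfxt Hftx t x Dt.
  (* The base point lies strictly to the left of [x], so that [E], stated only for [a <= y], holds
     in a neighbourhood of [x]. *)
  set (a := x - 1).
  assert (E : forall y, a <= y -> RInt (fxt t) a y = ft t y - ft t a).
  { intros y ay.
    apply (is_derive_on_Icc_unique 0 T (fun s => RInt (fx s) a y) t); auto.
    - apply is_derive_on_RInt_param; auto. intros s z Hs.
      apply (is_derive_on_interior 0 T); [exact Hs|]. apply Hfxt. unfold Icc; lra.
    - apply (is_derive_on_ext _ (fun s => f s y - f s a)); [exact Dt| |].
      + intros s Ds. symmetry. apply (is_RInt_unique (V := R_CompleteNormedModule)).
        apply (is_RInt_derive (V := R_CompleteNormedModule)).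
        * intros z _. now apply Hfx.
        * intros z _. now apply (continuous_strip_space T).
      + apply is_derive_on_minus; auto. }
  assert (D1 : is_derive (fun y => RInt (fxt t) a y) x (fxt t x)).
  { apply (is_derive_RInt (V := R_NormedModule) _ _ a).
    - apply filter_forall. intros y. apply (RInt_correct (V := R_CompleteNormedModule)).
      apply (ex_RInt_continuous (V := R_CompleteNormedModule)).
      intros z _. now apply (continuous_strip_space T).
    - now apply (continuous_strip_space T). }
  assert (D2 : is_derive (fun y => RInt (fxt t) a y) x (ftx t x)).
  { apply (is_derive_ext_loc (fun y => ft t y - ft t a)).
    - apply (filter_imp (fun y => a < y)).
      + intros y ay. symmetry. apply E. lra.
      + apply open_gt. unfold a; lra.
    - rewrite <- (Rminus_0_r (ftx t x)).
      apply (is_derive_minus (V := R_NormedModule)); [now apply Hftx|].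
      apply (is_derive_const (V := R_NormedModule)). }
  apply is_derive_unique in D1. apply is_derive_unique in D2. congruence.
Qed.

(** * Derivatives of u arctan u, and of periodic functions *)

Definition dxatan (u : R) : R := atan u + u / (1 + u ^ 2).

Lemma one_plus_sqr_pos (u : R) : 0 < 1 + u ^ 2.
Proof. pose proof (pow2_ge_0 u); lra. Qed.

Lemma is_derive_xatan (u : R) : is_derive (fun v => v * atan v) u (dxatan u).
Proof.
  pose proof (one_plus_sqr_pos u). unfold dxatan.
  auto_derive; [exact I|]. unfold Rsqr. field. lra.
Qed.

Lemma is_derive_dxatan (u : R) : is_derive dxatan u (2 / (1 + u ^ 2) ^ 2).
Proof.
  pose proof (one_plus_sqr_pos u). unfold dxatan.
  auto_derive; [lra|]. unfold Rsqr. field. lra.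
Qed.

Lemma is_derive_periodic (f : R -> R) (p x l m : R) :
  (forall y, f (y + p) = f y) -> is_derive f x l -> is_derive f (x + p) m -> l = m.
Proof.
  intros Hp Hl Hm.
  assert (D : is_derive f x m).
  { apply (is_derive_ext (fun y => f (y + p))); [exact Hp|].
    rewrite <- (Rmult_1_l m).
    apply (is_derive_comp (V := R_NormedModule) f (fun y => y + p)); [exact Hm|].
    auto_derive; [exact I|ring]. }
  apply is_derive_unique in Hl. apply is_derive_unique in D. congruence.
Qed.

(** * Monotonicity of the functional along the Boussinesq flow *)

Theorem propositionB3 (T : R) (h : R -> R -> R)
  (hT : 0 < T)
  (hsmooth : smooth_on_torus T h)
  (hpos : forall t x, Icc 0 T t -> 0 < h t x)
  (hsol : boussinesq_solution T h) :
  forall t, Icc 0 T t ->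
    exists l : R,
      is_derive_on (Icc 0 T)
        (fun s => RInt (fun x => partial_x h s x * atan (partial_x h s x)) 0 (2 * PI)) t l /\
      l <= 0.
Proof.
  destruct hsmooth as [hper hC].
  (* Order two supplies h_t, u = h_x, h_tx, u_t and u_x, with u, u_t and u_x continuous on the
     strip. *)
  destruct (hC 2%nat) as [_ [ht [u [Hht [Hu [[_ [htt [htx [_ [Hhtx [_ _]]]]]]
    [Cu [ut [ux [Hut [Hux [[Cut _] [Cux _]]]]]]]]]]]]].
  assert (T0 : 0 <= T) by lra.
  apply continuous_on_strip in Cu; [|exact T0].
  apply continuous_on_strip in Cut; [|exact T0].
  apply continuous_on_strip in Cux; [|exact T0].
  assert (Eu : forall s x, Icc 0 T s -> partial_x h s x = u s x).
  { intros s x Ds. apply is_derive_unique. now apply Hu. }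
  intros t Dt.
  assert (Emix : forall x, ut t x = htx t x).
  { intros x. now apply (mixed_partials_strip T h ht u). }
  (* The equation comes with its own time derivative [l]; uniqueness within [0,T] identifies it with
     [ht], and the product rule expands the flux term. *)
  assert (Eht : forall x, ht t x = u t x ^ 2 + h t x * ux t x).
  { intros x. destruct (hsol t x Dt) as [l [Hl El]].
    rewrite (is_derive_on_Icc_unique 0 T (fun s => h s x) t (ht t x) l); auto.
    replace l with (partial_x (fun s y => h s y * partial_x h s y) t x) by lra.
    apply is_derive_unique.
    apply (is_derive_ext (fun y => h t y * u t y)).
    { intros y. now rewrite Eu. }
    replace (u t x ^ 2 + h t x * ux t x) with (u t x * u t x + h t x * ux t x) by ring.
    apply (is_derive_mult (fun y => h t y) (fun y => u t y)); auto.
    intros; apply Rmult_comm. }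
  (* Periodicity passes from [h] to [u] and [ht]; this makes the boundary terms at 0 and 2 pi
     cancel. *)
  assert (Pu : u t (0 + 2 * PI) = u t 0).
  { symmetry. apply (is_derive_periodic (h t) (2 * PI) 0); auto. }
  assert (Pht : ht t (0 + 2 * PI) = ht t 0).
  { apply (is_derive_on_Icc_unique 0 T (fun s => h s 0) t); auto.
    apply (is_derive_on_ext _ (fun s => h s (0 + 2 * PI))); auto. }
  set (ft := fun s x => ut s x * dxatan (u s x)).
  assert (Cdx : forall v, continuous dxatan v).
  { intros v. apply (ex_derive_continuous (V := R_NormedModule)).
    eexists; apply is_derive_dxatan. }
  assert (Cft : continuous_strip T ft).
  { intros s x. apply (continuity_2d_pt_mult (fun s x => ut (clamp T s) x)
      (fun s x => dxatan (u (clamp T s) x))); [apply Cut|].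
    apply (continuous_strip_comp T dxatan u Cdx Cu). }
  exists (RInt (ft t) 0 (2 * PI)). pose proof PI_RGT_0 as pi0. split.
  - apply (is_derive_on_ext _ (fun s => RInt (fun x => u s x * atan (u s x)) 0 (2 * PI)));
      [exact Dt| |].
    { intros s Ds. apply RInt_ext. intros x _. now rewrite Eu. }
    apply (is_derive_on_RInt_param T (fun s x => u s x * atan (u s x))); auto; [lra| |].
    + apply (continuous_strip_comp T (fun v => v * atan v) u); [|exact Cu].
      intros v. apply (ex_derive_continuous (V := R_NormedModule)).
      eexists; apply is_derive_xatan.
    + intros s x Hs.
      apply (is_derive_comp (V := R_NormedModule) (fun v => v * atan v) (fun r => u r x)).
      * apply is_derive_xatan.
      * apply (is_derive_on_interior 0 T); [exact Hs|]. apply Hut. unfold Icc; lra.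
  (* [W] is the bracket g'(u) h_t - G(u) and [k] is g''. Its derivative [W'] is the integrand [ft]
     plus the dissipation k(u) h u_x^2. *)
  - set (W := fun x => dxatan (u t x) * ht t x
      - (atan (u t x) - u t x / (1 + u t x ^ 2))).
    set (k := fun v => 2 / (1 + v ^ 2) ^ 2).
    set (W' := fun x => ft t x + k (u t x) * h t x * ux t x ^ 2).
    assert (DW : forall x, is_derive W x (W' x)).
    { intros x.
      assert (DG : forall v, is_derive (fun v => atan v - v / (1 + v ^ 2)) v (k v * v ^ 2)).
      { intros v. pose proof (one_plus_sqr_pos v). unfold k.
        auto_derive; [lra|]. unfold Rsqr. field. lra. }
      (* Inserting h_t = u^2 + h u_x in k(u) u_x h_t, the part k(u) u_x u^2 cancels against the
         derivative of G(u), and k(u) h u_x^2 remains. *)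
      replace (W' x) with ((ux t x * k (u t x) * ht t x + dxatan (u t x) * htx t x)
        - ux t x * (k (u t x) * u t x ^ 2))
        by (unfold W', ft; rewrite Emix, Eht; ring).
      apply (is_derive_minus (V := R_NormedModule)).
      - apply (is_derive_mult (fun x => dxatan (u t x)) (fun x => ht t x)).
        + apply (is_derive_comp (V := R_NormedModule) dxatan (u t)).
          * apply is_derive_dxatan.
          * now apply Hux.
        + now apply Hhtx.
        + intros; apply Rmult_comm.
      - apply (is_derive_comp (V := R_NormedModule)
          (fun v => atan v - v / (1 + v ^ 2)) (u t)); [apply DG|now apply Hux]. }
    assert (Cft_t : forall x, continuous (ft t) x)
      by now apply (continuous_strip_space T).
    assert (CW' : forall x, continuous W' x).
    { assert (Ck : forall v, continuous k v).
      { intros v. apply (ex_derive_continuous (V := R_NormedModule)).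
        unfold k. pose proof (one_plus_sqr_pos v). auto_derive. nra. }
      intros x. apply (continuous_plus (V := R_NormedModule)); [apply Cft_t|].
      apply (continuous_mult (K := R_AbsRing)).
      - apply (continuous_mult (K := R_AbsRing)).
        + apply continuous_comp; [now apply (continuous_strip_space T)|apply Ck].
        + apply (ex_derive_continuous (V := R_NormedModule)).
          eexists; now apply Hu.
      - apply (continuous_comp (ux t) (fun v => v ^ 2)).
        + now apply (continuous_strip_space T).
        + apply (ex_derive_continuous (V := R_NormedModule)). now auto_derive. }
    (* Pointwise [ft t] is at most [W'], whose integral over a period is W(2 pi) - W(0) = 0. *)
    apply (is_RInt_le (ft t) W' 0 (2 * PI)); [lra| | |].
    + apply (RInt_correct (V := R_CompleteNormedModule)).
      apply (ex_RInt_continuous (V := R_CompleteNormedModule)). auto.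
    (* The second 0 is the value of the integral; the first is its lower bound. *)
    + replace 0 with (minus (W (2 * PI)) (W 0)) at 2.
      * apply (is_RInt_derive (V := R_CompleteNormedModule)); auto.
      * rewrite Rplus_0_l in Pu, Pht. unfold W. rewrite Pu, Pht.
        apply (minus_eq_zero (G := R_AbelianGroup)).
    + intros x _. unfold W'.
      assert (0 <= k (u t x) * h t x * ux t x ^ 2).
      { apply Rmult_le_pos; [apply Rmult_le_pos|apply pow2_ge_0].
        - pose proof (one_plus_sqr_pos (u t x)). unfold k.
          apply Rlt_le, Rdiv_lt_0_compat; [lra|now apply pow_lt].
        - now apply Rlt_le, hpos. }
      lra.
Qed.
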